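(* Suppose $\mu$ is a solution of the recursive distributional equation $X\overset{d}{=}g(\xi;(X_j:1\le j\le^* N))$ on $S$, and let $(X_{\mathbf i})_{\mathbf i\in\mathcal V}$ be an invariant recursive tree process (RTP) with marginal $\mu$. Then the tail of $(X_{\mathbf i})_{\mathbf i\in\mathcal V}$ is trivial if the RTP is endogenous.
   Context: Recursive distributional equation (RDE). Let $S$ be a space and $\mathcal P(S)$ the set of all probabilities on $S$. Let $(\xi,N)$ be a random pair with known distribution, where $N$ is a non-negative integer valued random variable which may take the value $\infty$, and let $g$ be a given $S$-valued function. The notation $j\le^* N$ means $j\le N$ if $N<\infty$, and $j<\infty$ if $N=\infty$. In the RDE $$X\overset{d}{=} g(\xi;(X_j:1\le j\le^* N))\quad\text{on } S,$$ $(X_j)_{j\ge1}$ are i.i.d. $S$-valued random variables with the same distribution as $X$ and are independent of the pair $(\xi,N)$; the distribution of $X$ is unknown. A solution is a $\mu\in\mathcal P(S)$ such that the identity in distribution holds when $X$ has distribution $\mu$. Recursive tree process. Let $\mathcal V=\{\emptyset\}\cup\bigcup_{d\ge1}\mathbb N^d$ (finite words over $\mathbb N=\{1,2,\dots\}$), with $|\mathbf i|$ the length of the word $\mathbf i$, and $\mathbf i j$ the word obtained by appending $j$ to $\mathbf i$ ($\emptyset j=j$). Let $(\xi_{\mathbf i},N_{\mathbf i})_{\mathbf i\in\mathcal V}$ be i.i.d. copies of $(\xi,N)$; these are called the innovation process. Given a solution $\mu$ of the RDE, one can construct, using Kolmogorov's consistency theorem, a process $(X_{\mathbf i})_{\mathbf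 i\in\mathcal V}$ such that: (i) $X_{\mathbf i}\sim\mu$ for all $\mathbf i\in\mathcal V$; (ii) for each $d\ge0$, the variables $(X_{\mathbf i})_{|\mathbf i|=d}$ are independent; (iii) $X_{\mathbf i}=g(\xi_{\mathbf i};(X_{\mathbf i j}:1\le j\le^* N_{\mathbf i}))$ for all $\mathbf i\in\mathcal V$; (iv) for every $\mathbf i\in\mathcal V$, $X_{\mathbf i}$ is independent of $\{(\xi_{\mathbf i'},N_{\mathbf i'}):|\mathbf i'|<|\mathbf i|\}$. The process $(X_{\mathbf i})_{\mathbf i\in\mathcal V}$ is called an invariant recursive tree process (RTP) with marginal $\mu$. Endogeny. The invariant RTP is called endogenous if the root variable $X_\emptyset$ is measurable with respect to the $\sigma$-algebra $\mathcal G=\sigma(\{(\xi_{\mathbf i},N_{\mathbf i}):\mathbf i\in\mathcal V\})$. Tail. Let $\mathcal H_n=\sigma(\{X_{\mathbf i}:|\mathbf i|\ge n\})$. The tail $\sigma$-algebra of the RTP is $\mathcal H=\bigcap_{n\ge0}\mathcal H_n$. The tail is trivial if the $\sigma$-algebra $\mathcal H$ is trivial, that is, every event in $\mathcal H$ has probability $0$ or $1$.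
   Formalization: In (iv) the whole generation (X_i)_{|i|=d}, not only each single X_i, is assumed independent of the innovations (ξ_i',N_i') with |i'|<d, as in the Kolmogorov construction; with independence of single X_i only, the claim is false. *)

(* Defs.v *)
From HB Require Import structures.
From mathcomp Require Import all_boot all_order all_algebra finmap.
From mathcomp Require Import all_classical all_reals all_analysis.

Set Implicit Arguments.
Unset Strict Implicit.
Unset Printing Implicit Defensive.

Local Open Scope classical_set_scope.
Local Open Scope ring_scope.

(** {0, 1, 2, ...} together with infinity ([None]), with its discrete
    sigma-algebra. *)
Definition enat : Type := option nat.
HB.instance Definition _ := Pointed.on enat.
HB.instance Definition _ := @isMeasurable.Build default_measure_display
  enat discrete_measurable discrete_measurable0
  discrete_measurableC discrete_measurableU.

(** The disjoint union of the powers S^m, 0 <= m <= infinity, in which the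
    second argument [(X_j : 1 <= j <=* N)] of g lives. *)
Inductive arglist (S : Type) : Type :=
| FinArgs of seq S
| InfArgs of nat -> S.

Definition arglen S (w : arglist S) : enat :=
  if w is FinArgs s then Some (size s) else None.

Definition argnth S (w : arglist S) (k : nat) : option S :=
  match w with FinArgs s => onth s k | InfArgs x => Some (x k) end.

(** [args N x] is [(x_j : 1 <= j <=* N)]; entries are numbered from 0, so
    [x j] stands for [x_(j+1)]. *)
Definition args S (N : enat) (x : nat -> S) : arglist S :=
  if N is Some n then FinArgs (mkseq x n) else InfArgs x.

HB.instance Definition _ (S : Type) := gen_eqMixin (arglist S).
HB.instance Definition _ (S : Type) := gen_choiceMixin (arglist S).
HB.instance Definition _ (S : Type) := isPointed.Build (arglist S) (FinArgs [::]).

(** Generators of the disjoint-union sigma-algebra: fixing the length singles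
    out a component S^m, and the coordinate cylinders generate the product
    sigma-algebra on it. *)
Definition arglist_gen d (S : measurableType d) : set (set (arglist S)) :=
  [set [set w | arglen w = n] | n in [set: enat]] `|`
  \bigcup_(k in [set: nat])
    [set [set w | exists2 x, argnth w k = Some x & A x]
       | A in @measurable _ S].

Arguments arglist_gen {d} S.

Definition arglist_display : measure_display -> measure_display.
Proof. by []. Qed.

HB.instance Definition _ d (S : measurableType d) :=
  @isMeasurable.Build (arglist_display d) (arglist S) <<s arglist_gen S >>
    (@sigma_algebra0 _ setT (arglist_gen S))
    (@sigma_algebraC _ (arglist_gen S))
    (@sigma_algebra_bigcup _ setT (arglist_gen S)).

Section independence.
Context d (Om : measurableType d) (R : realType) (P : probability Om R).

Definition mutual_indep (I : choiceType) (D : set I)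
    (F : I -> set (set Om)) : Prop :=
  forall (J : {fset I}) (E : I -> set Om),
    [set` J] `<=` D -> (forall i, i \in J -> F i (E i)) ->
    P (\bigcap_(i in [set` J]) E i) = (\prod_(i <- J) P (E i))%E.

Definition indep2 (F G : set (set Om)) : Prop :=
  forall A B, F A -> G B -> P (A `&` B) = (P A * P B)%E.

Definition sigma_rv d' (T : measurableType d') (X : Om -> T) : set (set Om) :=
  preimage_set_system [set: Om] X measurable.

Definition sigma_family (I : Type) (D : set I) d' (T : measurableType d')
    (X : I -> Om -> T) : set (set Om) :=
  <<s \bigcup_(i in D) sigma_rv (X i) >>.

Definition has_law d' (T : measurableType d') (X : {RV P >-> T})
    (mu : probability T R) : Prop :=
  forall A, measurable A -> distribution P X A = mu A.

End independence.

Section rtp.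
Context dT (Theta : measurableType dT) dS (S : measurableType dS)
  (R : realType).

(** [nu] is the given law of the pair (xi, N). *)
Definition rde_solution (nu : probability (Theta * enat)%type R)
    (g : Theta * arglist S -> S) (mu : probability S R) : Prop :=
  forall (d : measure_display) (Om : measurableType d) (P : probability Om R)
    (W : {RV P >-> (Theta * enat)%type}) (X : nat -> {RV P >-> S}),
    has_law W nu ->
    (forall j, has_law (X j) mu) ->
    mutual_indep P [set: nat] (fun j => sigma_rv (X j)) ->
    indep2 P (sigma_family [set: nat] (fun j => X j : Om -> S)) (sigma_rv W) ->
    forall A, measurable A ->
      P [set w | A (g ((W w).1, args (W w).2 (fun j => X j w)))] = mu A.

Context d (Om : measurableType d) (P : probability Om R).

(** Words over {1, 2, ...} are encoded as [seq nat], the letter [j] standing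
    for [j+1]; [rcons i j] is the word obtained by appending a letter. *)
Definition innovation_process (nu : probability (Theta * enat)%type R)
    (W : seq nat -> {RV P >-> (Theta * enat)%type}) : Prop :=
  (forall i, has_law (W i) nu) /\
  mutual_indep P [set: seq nat] (fun i => sigma_rv (W i)).

(** In the last clause the whole generation [(X_i)_{|i| = n}] is required to be
    jointly independent of the innovations of the earlier generations, as it is
    in the process built from Kolmogorov's theorem.  Independence of each single
    [X_i] would not be enough: let S = {0,1}, N = 2, g(xi; x, y) = x xor y, mu
    uniform, and (xi_i) i.i.d. fair bits; put X_root = xi_root and, with fresh
    fair bits for X_(i1), X_(i2) = X_i xor X_(i1).  All clauses then hold with
    single-variable independence, but X_root is both a function of the
    innovations and, being the xor of any generation, a tail variable.
    The recursion, an identity of random variables, is required almost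
    surely. *)
Definition invariant_rtp (g : Theta * arglist S -> S) (mu : probability S R)
    (W : seq nat -> {RV P >-> (Theta * enat)%type})
    (X : seq nat -> {RV P >-> S}) : Prop :=
  [/\ forall i, has_law (X i) mu,
      forall n, mutual_indep P [set i | size i = n] (fun i => sigma_rv (X i)),
      forall i, {ae P, forall w,
        X i w = g ((W i w).1, args (W i w).2 (fun j => X (rcons i j) w))} &
      forall n, indep2 P
        (sigma_family [set i | size i = n] (fun i => X i : Om -> S))
        (sigma_family [set i | (size i < n)%N]
           (fun i => W i : Om -> (Theta * enat)%type))].

Definition innovation_sigma (W : seq nat -> {RV P >-> (Theta * enat)%type}) :
    set (set Om) :=
  sigma_family [set: seq nat] (fun i => W i : Om -> (Theta * enat)%type).

(** The sigma-algebra G of the innovations is completed by the P-null sets, so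
    that endogeny depends only on the joint law of the process: in the canonical
    (product space) construction the coordinate X_root is never measurable for
    the uncompleted G unless it is trivial.  Strict measurability is a special
    case, see [strict_endogenous]. *)
Definition endogenous (W : seq nat -> {RV P >-> (Theta * enat)%type})
    (X : seq nat -> {RV P >-> S}) : Prop :=
  sigma_rv (X [::]) `<=`
    <<s innovation_sigma W `|` [set B | P.-negligible B] >>.

Lemma strict_endogenous (W : seq nat -> {RV P >-> (Theta * enat)%type})
    (X : seq nat -> {RV P >-> S}) :
  sigma_rv (X [::]) `<=` innovation_sigma W -> endogenous W X.
Proof. by move=> h A /h GA; apply: sub_sigma_algebra; left. Qed.

Definition tail_sigma (X : seq nat -> {RV P >-> S}) : set (set Om) :=
  \bigcap_(n in [set: nat])
    sigma_family [set i | (n <= size i)%N] (fun i => X i : Om -> S).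

Definition trivial_sigma (H : set (set Om)) : Prop :=
  forall A, H A -> P A = 0%E \/ P A = 1%E.

End rtp.

(* Main.v *)
Require Import Defs.
From HB Require Import structures.
From mathcomp Require Import all_boot all_order all_algebra finmap.
From mathcomp Require Import all_classical all_reals all_analysis.

(** The tail is trivial for the reason behind Kolmogorov's zero-one law: up to
    null sets, a tail event depends only on innovations arbitrarily far down
    the tree, while it is also an event of the innovations as a whole.

    Endogeny makes the root state an almost sure function of the innovations.
    The subtree hanging at any vertex [j] is a copy of the whole tree, so the
    state at [j] is almost surely the same function of the innovations at the
    vertices below [j] ([endogenous_subtree]).  Hence the sigma-algebra of the
    states of depth at least [n] lies in the completion of the sigma-algebra of
    the innovations of depth at least [n], which is independent of the
    innovations of depth less than [n] ([mutual_indep_disjoint]).  A tail event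
    [A] is therefore independent of the innovations of depth less than [n] for
    every [n], thus of all of them, thus of itself, since it lies in their
    completion; so [P A = P A * P A] ([zero_one_indep]).

    What has to be proved about the copies is that the law of the root state
    jointly with all the innovations is the same in the subtree at [j] as in the
    whole tree ([same_law_root]).  With the tree cut at depth [n], the states of
    generation [n] are i.i.d. and independent of the earlier i.i.d. innovations,
    which determines their joint law ([same_law_generation]); the recursion,
    read as a map on trajectories that fixes the process almost surely, carries
    this law from generation [n] up to the root ([same_law_level]); and events
    of the root state and of the innovations up to some finite depth generate
    everything that is needed. *)

Import Order.TTheory GRing.Theory Num.Theory.

Set Implicit Arguments.
Unset Strict Implicit.

Local Open Scope classical_set_scope.
Local Open Scope ring_scope.

(** * Sigma-algebras *)

Section sigma_algebras.
Context {T : Type}.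
Implicit Types (G M : set (set T)) (A B : set T).

Lemma sigma_algebra_setC M A : sigma_algebra setT M -> M A -> M (~` A).
Proof. by move=> [_ MC _] /MC; rewrite setTD. Qed.

Lemma sigma_algebra_setT M : sigma_algebra setT M -> M setT.
Proof. by move=> [M0 MC _]; rewrite -(setD0 setT); exact: MC. Qed.

Lemma sigma_algebra_setI M : sigma_algebra setT M -> setI_closed M.
Proof. by case/sigma_algebraP. Qed.

Lemma sigma_algebra_setY M A B :
  sigma_algebra setT M -> M A -> M B -> M (A `+` B).
Proof.
move=> sM MA MB.
have MD C D : M C -> M D -> M (C `\` D).
  by move=> MC MD; rewrite setDE; apply: sigma_algebra_setI => //;
    exact: sigma_algebra_setC.
rewrite setY_def -(setCK (_ `|` _)) setCU.
apply: sigma_algebra_setC => //.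
by apply: sigma_algebra_setI => //; apply: sigma_algebra_setC => //; exact: MD.
Qed.

Lemma preimage_g_sigma {U : Type} (f : T -> U) (G : set (set U)) M :
  sigma_algebra setT M -> (forall E, G E -> M (f @^-1` E)) ->
  forall E, <<s G >> E -> M (f @^-1` E).
Proof.
move=> sM GM E sE.
have /(_ E sE) : <<s G >> `<=` image_set_system setT f M.
  apply: smallest_sub; first exact: sigma_algebra_image.
  by move=> A /GM; rewrite /image_set_system/= setTI.
by rewrite /image_set_system/= setTI.
Qed.

(** An increasing union of sigma-algebras need not be a sigma-algebra, but it is
    a pi-system, which is what uniqueness of measures asks for. *)
Lemma bigcup_g_sigma_setI (G : nat -> set (set T)) :
  (forall m n, (m <= n)%N -> G m `<=` G n) ->
  setI_closed (\bigcup_n <<s G n >>).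
Proof.
move=> ndG A B [m _ mA] [n _ nB]; exists (maxn m n) => //.
apply: (sigma_algebra_setI (smallest_sigma_algebra setT _)).
- exact: (@sub_sigma_algebra2 _ setT _ _ (ndG _ _ (leq_maxl m n))) mA.
- exact: (@sub_sigma_algebra2 _ setT _ _ (ndG _ _ (leq_maxr m n))) nB.
Qed.

End sigma_algebras.

(** * Measures determined by a pi-system *)

Section eq_measure.
Context d (Om : measurableType d) (R : realType).

(** Pi-lambda theorem for two image measures.  Having two maps and two measures
    lets it compare the laws of two processes as well as the measures
    [P (A `&` _)] and [P A * P _]. *)
Lemma eq_measure_g_sigma T (m1 m2 : {finite_measure set Om -> \bar R})
    (Z1 Z2 : Om -> T) (C : set (set T)) :
  setI_closed C ->
  (forall E, C E -> measurable (Z1 @^-1` E)) ->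
  (forall E, C E -> measurable (Z2 @^-1` E)) ->
  m1 setT = m2 setT ->
  (forall E, C E -> m1 (Z1 @^-1` E) = m2 (Z2 @^-1` E)) ->
  forall E, <<s C >> E -> m1 (Z1 @^-1` E) = m2 (Z2 @^-1` E).
Proof.
move=> CI mZ1 mZ2 m12T m12 E.
pose H := [set E | [/\ measurable (Z1 @^-1` E), measurable (Z2 @^-1` E) &
                       m1 (Z1 @^-1` E) = m2 (Z2 @^-1` E)]].
suff : <<s C >> `<=` H by move=> /[apply] -[].
apply: (lambda_system_subset CI) => //; last by move=> A CA; split; auto.
apply/dynkin_lambda_system; split.
- by split; rewrite preimage_setT.
- move=> A [mA1 mA2 eqA]; split.
  1,2: by rewrite preimage_setC; exact: measurableC.
  have mC (m : {finite_measure set Om -> \bar R}) B : measurable B ->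
      m (~` B) = (m setT - m B)%E.
    move=> mB; rewrite -setTD measureD// ?setTI// ltey_eq.
    by rewrite fin_num_measure.
  by rewrite 2!preimage_setC !mC// m12T eqA.
- move=> F tF HF; split; rewrite ?preimage_bigcup.
  + by apply: bigcupT_measurable => n; case: (HF n).
  + by apply: bigcupT_measurable => n; case: (HF n).
  + rewrite !measure_bigcup//; try by move=> n _; case: (HF n).
    * by apply: eq_eseriesr => n _; case: (HF n).
    * move=> i j _ _ [x [/= Fi Fj]]; apply: tF => //; by exists (Z2 x).
    * move=> i j _ _ [x [/= Fi Fj]]; apply: tF => //; by exists (Z1 x).
Qed.

Variable P : probability Om R.

Lemma measure_setY_negligible A B : measurable A -> measurable B ->
  P.-negligible (A `+` B) -> P A = P B.
Proof.
suff H A' B' : measurable A' -> measurable B' ->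
    P.-negligible (A' `+` B') -> (P A' <= P B')%E.
  by move=> mA mB AB; apply/eqP; rewrite eq_le !H// setYC.
move=> mA mB [N [mN N0 ABN]]; rewrite -[leRHS]adde0 -N0.
apply: (@le_trans _ _ (P (B' `|` N))); last exact: measureU2.
apply: le_measure; rewrite ?inE//; first exact: measurableU.
move=> x Ax; have [Bx|nBx] := pselect (B' x); first by left.
by right; apply: ABN; left.
Qed.

Lemma measure_ae_preimage T (Z1 Z2 : Om -> T) (E : set T) :
  {ae P, forall w, Z1 w = Z2 w} ->
  measurable (Z1 @^-1` E) -> measurable (Z2 @^-1` E) ->
  P (Z1 @^-1` E) = P (Z2 @^-1` E).
Proof.
move=> Z12 m1 m2; apply: measure_setY_negligible => //.
apply: negligibleS Z12 => w /= [] [] + + e; by rewrite e.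
Qed.

(** One side is extended at a time: for a fixed event [A], the finite measures
    [P (A `&` _)] and [P A * P _] agree on a pi-system. *)
Lemma indep2_g_sigma (C D : set (set Om)) :
  setI_closed C -> setI_closed D -> C `<=` measurable -> D `<=` measurable ->
  indep2 P C D -> indep2 P <<s C >> <<s D >>.
Proof.
have H (A : set Om) C' : measurable A -> setI_closed C' -> C' `<=` measurable ->
    (forall B, C' B -> P (A `&` B) = (P A * P B)%E) ->
    forall B, <<s C' >> B -> P (A `&` B) = (P A * P B)%E.
  move=> mA CI Cm AC B sB.
  have fA : P A \is a fin_num by exact: fin_num_measure.
  pose r : {nonneg R} := NngNum (fine_ge0 (measure_ge0 P A)).
  have -> : P (A `&` B) = mrestr P mA (idfun @^-1` B) by rewrite setIC.
  have -> : (P A * P B)%E = mscale r P (idfun @^-1` B).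
    by rewrite /mscale/= fineK.
  apply: (eq_measure_g_sigma CI) sB => //= [|E /AC PAE].
  - by rewrite /mrestr /mscale/= setTI probability_setT mule1 fineK.
  - by rewrite /mrestr /mscale/= fineK// setIC.
move=> CI DI Cm Dm CD A B CA DB.
have mA : measurable A.
  by apply: (smallest_sub (sigma_algebra_measurable _) Cm) CA.
have mB : measurable B.
  by apply: (smallest_sub (sigma_algebra_measurable _) Dm) DB.
apply: (H A D) => // B' DB'.
rewrite setIC muleC; apply: (H B' C) => //; first exact: Dm.
by move=> A' CA'; rewrite setIC muleC CD.
Qed.

End eq_measure.

(** * Mutually independent sigma-algebras *)

Section cylinders.
Context {T : Type} {I : choiceType}.
Implicit Types (D : set I) (F : I -> set (set T)).

(** These finite intersections are the events about which mutual independence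
    speaks; when the [F i] are sigma-algebras, they form a pi-system generating
    their join over [D]. *)
Definition cylinders D F : set (set T) :=
  [set A | exists (J : {fset I}) (E : I -> set T),
    [/\ [set` J] `<=` D, forall i, i \in J -> F i (E i) &
        A = \bigcap_(i in [set` J]) E i]].

(** Two intersections are indexed by different finite sets; both are rewritten
    over the union, with the whole space as the missing factors. *)
Lemma cylinders_setI D F :
  (forall i, F i setT) -> (forall i, setI_closed (F i)) ->
  setI_closed (cylinders D F).
Proof.
move=> FT FI _ _ [J1 [E1 [J1D FE1 ->]]] [J2 [E2 [J2D FE2 ->]]].
pose E (J : {fset I}) (G : I -> set T) i := if i \in J then G i else setT.
exists (J1 `|` J2)%fset, (fun i => E J1 E1 i `&` E J2 E2 i); split.
- by move=> i /=; rewrite inE => /orP[/J1D|/J2D].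
- by move=> i _; rewrite /E; apply: FI; case: ifP => // iJ;
    [exact: FE1|exact: FE2].
- apply/seteqP; split=> [w [w1 w2] i _|w wE].
    by rewrite /E; split; case: ifP => // iJ; [exact: w1|exact: w2].
  split=> i /= iJ.
    by have [] := wE i; rewrite /E /= ?inE iJ.
  by have [] := wE i; rewrite /E /= ?inE iJ ?orbT.
Qed.

Lemma g_sigma_cylinders D F :
  <<s \bigcup_(i in D) F i >> `<=` <<s cylinders D F >>.
Proof.
apply: sub_sigma_algebra2 => A [i Di FA].
exists [fset i]%fset, (fun=> A); split => //.
- by move=> j /=; rewrite inE => /eqP ->.
- by move=> j; rewrite inE => /eqP ->.
- by apply/seteqP; split=> [w Aw j _ //|w]; apply; rewrite /= inE.
Qed.

End cylinders.

Section mutual_indep.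
Context d (Om : measurableType d) (R : realType) (P : probability Om R).

Lemma mutual_indep_reindex (I I' : choiceType) (h : I' -> I) (k : I -> I')
    (D : set I) (D' : set I') (F : I -> set (set Om)) :
  cancel h k -> (forall i, D' i -> D (h i)) ->
  mutual_indep P D F -> mutual_indep P D' (F \o h).
Proof.
move=> hK D'D PDF J E JD' FE.
have := PDF [fset h i | i in J]%fset (E \o k) => /= H.
rewrite big_imfset/= in H; last by move=> x y _ _; exact: (can_inj hK).
have -> : (\prod_(i <- J) P (E i) = \prod_(i <- J) P (E (k (h i))))%E.
  by apply: eq_bigr => i _; rewrite hK.
rewrite -H.
- congr (P _); apply/seteqP; split=> w wE i /=.
    by move=> /imfsetP[j /= jJ ->]; rewrite hK; exact: wE.
  by move=> iJ; rewrite -(hK i); apply: wE; apply/imfsetP; exists i.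
- by move=> i /= /imfsetP[j /= jJ ->]; apply: D'D; exact: JD'.
- by move=> i /imfsetP[j /= jJ ->]; rewrite hK; exact: FE.
Qed.

Section sigma_algebras.
Context {I : choiceType} {T : Type}.
Implicit Types (D : set I).

(** The law of an independent family is determined by its marginals.  The family
    is given by sigma-algebras on the target of two maps, so that its members may
    be variables with values in different spaces. *)
Lemma mutual_indep_law D (F : I -> set (set T)) (Z1 Z2 : Om -> T) :
  (forall i, sigma_algebra setT (F i)) ->
  (forall i E, F i E -> measurable (Z1 @^-1` E)) ->
  (forall i E, F i E -> measurable (Z2 @^-1` E)) ->
  mutual_indep P D (fun i => preimage_set_system setT Z1 (F i)) ->
  mutual_indep P D (fun i => preimage_set_system setT Z2 (F i)) ->
  (forall i E, F i E -> P (Z1 @^-1` E) = P (Z2 @^-1` E)) ->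
  forall E, <<s \bigcup_(i in D) F i >> E -> P (Z1 @^-1` E) = P (Z2 @^-1` E).
Proof.
move=> sF mZ1 mZ2 ind1 ind2 Z12 E /g_sigma_cylinders sE.
have mcyl (Z : Om -> T) A : (forall i E, F i E -> measurable (Z @^-1` E)) ->
    cylinders D F A -> measurable (Z @^-1` A).
  move=> mZ [J [G [_ FG ->]]]; rewrite preimage_bigcap bigcap_fset big_seq.
  by apply: bigsetI_measurable => i /FG; exact: mZ.
apply: (eq_measure_g_sigma _ _ _ _ _ sE) => //.
- apply: cylinders_setI => i; first exact: sigma_algebra_setT.
  exact: sigma_algebra_setI.
- by move=> A; exact: mcyl.
- by move=> A; exact: mcyl.
- move=> _ [J [G [JD FG ->]]].
  have indJ Z : mutual_indep P D (fun i => preimage_set_system setT Z (F i)) ->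
      P (Z @^-1` \bigcap_(i in [set` J]) G i) =
      (\prod_(i <- J) P (Z @^-1` G i))%E.
    rewrite preimage_bigcap; apply=> // i /FG FiG.
    by exists (G i); rewrite ?setTI.
  apply: (etrans (indJ _ ind1)); apply/esym/(etrans (indJ _ ind2)).
  by rewrite big_seq [RHS]big_seq; apply: eq_bigr => i /FG FiG; rewrite (Z12 i).
Qed.

(** Grouping: intersections indexed by disjoint finite sets merge into a single
    one, whose probability is the product over the union. *)
Lemma mutual_indep_disjoint D D1 D2 (F : I -> set (set Om)) :
  (forall i, sigma_algebra setT (F i)) -> (forall i, F i `<=` measurable) ->
  D1 `<=` D -> D2 `<=` D -> D1 `&` D2 = set0 ->
  mutual_indep P D F ->
  indep2 P <<s \bigcup_(i in D1) F i >> <<s \bigcup_(i in D2) F i >>.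
Proof.
move=> sF mF D1D D2D D12 PDF A B /g_sigma_cylinders sA /g_sigma_cylinders sB.
have cylI D' : setI_closed (cylinders D' F).
  apply: cylinders_setI => i; first exact: sigma_algebra_setT.
  exact: sigma_algebra_setI.
have mcyl D' : cylinders D' F `<=` measurable.
  move=> _ [J [G [_ FG ->]]]; rewrite bigcap_fset big_seq.
  by apply: bigsetI_measurable => i /FG; exact: mF.
apply: (indep2_g_sigma (cylI D1) (cylI D2) (mcyl D1) (mcyl D2)) sA sB.
move=> _ _ [J1 [E1 [J1D FE1 ->]]] [J2 [E2 [J2D FE2 ->]]].
pose E i := if i \in J1 then E1 i else E2 i.
have J21 i : i \in J2 -> (i \in J1) = false.
  move=> i2; apply/negP => i1; suff : set0 i by [].
  by rewrite -D12; split; [exact: J1D|exact: J2D].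
have EJ1 : \bigcap_(i in [set` J1]) E1 i = \bigcap_(i in [set` J1]) E i.
  by apply: eq_bigcapr => i /= i1; rewrite /E i1.
have EJ2 : \bigcap_(i in [set` J2]) E2 i = \bigcap_(i in [set` J2]) E i.
  by apply: eq_bigcapr => i /= i2; rewrite /E J21.
have FE1' i : i \in J1 -> F i (E i) by move=> i1; rewrite /E i1; exact: FE1.
have FE2' i : i \in J2 -> F i (E i) by move=> i2; rewrite /E J21//; exact: FE2.
rewrite EJ1 EJ2 -bigcap_setU.
have -> : [set` J1] `|` [set` J2] = [set` (J1 `|` J2)%fset].
  by apply/seteqP; split=> i /=; rewrite inE => /orP.
rewrite (PDF J1)//; last by move=> i /J1D/D1D.
rewrite (PDF J2)//; last by move=> i /J2D/D2D.
rewrite PDF; last 2 first.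
- by move=> i /=; rewrite inE => /orP[/J1D/D1D|/J2D/D2D].
- by move=> i; rewrite inE => /orP[/FE1'|/FE2'].
rewrite (big_fsetID _ (mem J1)) /=; congr (_ * _)%E.
- apply: perm_big; apply: uniq_perm => // i; rewrite !inE/=.
  by case: (boolP (i \in J1)) => //=; rewrite ?andbF.
- apply: perm_big; apply: uniq_perm => // i; rewrite !inE/=.
  case: (boolP (i \in J2)) => [/J21 -> //|]; rewrite ?orbF.
  by case: (i \in J1).
Qed.

End sigma_algebras.

(** Two independent blocks: the joint law is determined by the law of each, since
    the events [A `&` B], with one factor from each block, form a pi-system. *)
Lemma indep2_law T (G1 G2 : set (set T)) (Z1 Z2 : Om -> T) :
  (forall E, (G1 `|` G2) E -> measurable (Z1 @^-1` E)) ->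
  (forall E, (G1 `|` G2) E -> measurable (Z2 @^-1` E)) ->
  indep2 P (preimage_set_system setT Z1 <<s G1 >>)
           (preimage_set_system setT Z1 <<s G2 >>) ->
  indep2 P (preimage_set_system setT Z2 <<s G1 >>)
           (preimage_set_system setT Z2 <<s G2 >>) ->
  (forall E, <<s G1 >> E -> P (Z1 @^-1` E) = P (Z2 @^-1` E)) ->
  (forall E, <<s G2 >> E -> P (Z1 @^-1` E) = P (Z2 @^-1` E)) ->
  forall E, <<s G1 `|` G2 >> E -> P (Z1 @^-1` E) = P (Z2 @^-1` E).
Proof.
move=> mZ1 mZ2 ind1 ind2 law1 law2 E sE.
have mZ (Z : Om -> T) G : (forall E, G E -> measurable (Z @^-1` E)) ->
    forall E, <<s G >> E -> measurable (Z @^-1` E).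
  by move=> mG; apply: preimage_g_sigma => //; exact: sigma_algebra_measurable.
have mR (Z : Om -> T) : (forall E, (G1 `|` G2) E -> measurable (Z @^-1` E)) ->
    forall A B, <<s G1 >> A -> <<s G2 >> B -> measurable (Z @^-1` (A `&` B)).
  move=> mG A B sA sB; rewrite preimage_setI; apply: measurableI.
    by apply: mZ sA => {}A A1; apply: mG; left.
  by apply: mZ sB => {}B B2; apply: mG; right.
pose C := [set A `&` B | A in <<s G1 >> & B in <<s G2 >>].
have {}sE : <<s C >> E.
  apply: sub_sigma_algebra2 sE => A [GA|GA].
    exists A; first exact: sub_sigma_algebra.
    exists setT; last by rewrite setIT.
    exact: (sigma_algebra_setT (smallest_sigma_algebra _ _)).
  exists setT; first exact: (sigma_algebra_setT (smallest_sigma_algebra _ _)).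
  by exists A; [exact: sub_sigma_algebra|rewrite setTI].
apply: (eq_measure_g_sigma _ _ _ _ _ sE) => //.
- move=> _ _ [A1 sA1 [B1 sB1 <-]] [A2 sA2 [B2 sB2 <-]].
  have sI := sigma_algebra_setI (smallest_sigma_algebra _ _).
  exists (A1 `&` A2); first exact: sI.
  by exists (B1 `&` B2); [exact: sI|rewrite setIACA].
- by move=> _ [A sA [B sB <-]]; exact: mR.
- by move=> _ [A sA [B sB <-]]; exact: mR.
- move=> _ [A sA [B sB <-]]; rewrite !preimage_setI.
  have memZ Z G C' : <<s G >> C' ->
      preimage_set_system setT Z <<s G >> (Z @^-1` C').
    by exists C'; rewrite ?setTI.
  apply: (etrans (ind1 _ _ _ _)); [exact: memZ|exact: memZ|].
  apply/esym/(etrans (ind2 _ _ _ _)); [exact: memZ|exact: memZ|].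
  by rewrite law1// law2.
Qed.

End mutual_indep.

(** * Completion and the zero-one law *)

Section ae_closure.
Context d (Om : measurableType d) (R : realType) (P : probability Om R).
Implicit Types F G : set (set Om).

(** The events of the completion of [F], described by a representative in [F]:
    this description transfers to another process along an equality of laws. *)
Definition ae_closure F : set (set Om) :=
  [set A | exists2 B, F B & P.-negligible (A `+` B)].

Lemma sub_ae_closure F G : F `<=` G -> ae_closure F `<=` ae_closure G.
Proof. by move=> FG A [B /FG GB AB]; exists B. Qed.

Lemma sigma_algebra_ae_closure F :
  sigma_algebra setT F -> sigma_algebra setT (ae_closure F).
Proof.
move=> sF; split.
- exists set0; first by case: sF.
  by rewrite setYK; exact: negligible_set0.
- move=> A [B FB AB]; rewrite setTD; exists (~` B).
    exact: sigma_algebra_setC.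
  apply: negligibleS AB => w /= [[nA /contrapT Bw]|[nB /contrapT Aw]].
    by right.
  by left.
- move=> A /(_ _)/cid2-/all_sig2[B FB AB]; exists (\bigcup_n B n).
    by case: sF => _ _; apply.
  apply: negligibleS (negligible_bigcup AB) => w /=.
  case=> [[[n _ An] nB]|[[n _ Bn] nA]].
    by exists n => //=; left; split => // Bn; apply: nB; exists n.
  by exists n => //=; right; split => // An; apply: nA; exists n.
Qed.

(** Adding the null sets as generators yields nothing more than modifying events
    of [F] on null sets. *)
Lemma ae_closure_complete F : sigma_algebra setT F ->
  <<s F `|` [set B | P.-negligible B] >> `<=` ae_closure F.
Proof.
move=> sF; apply: smallest_sub; first exact: sigma_algebra_ae_closure.
move=> A [FA|nA].
  by exists A => //; rewrite setYK; exact: negligible_set0.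
by exists set0; [case: sF|rewrite setY0].
Qed.

Lemma ae_closure_indep2 F G A C : F `<=` measurable -> G `<=` measurable ->
  indep2 P F G -> measurable A -> ae_closure F A -> G C ->
  P (A `&` C) = (P A * P C)%E.
Proof.
move=> mF mG FG mA [B FB AB] GC; have mB := mF _ FB; have mC := mG _ GC.
rewrite (measure_setY_negligible mA mB AB) -(FG _ _ FB GC).
apply: measure_setY_negligible; [exact: measurableI|exact: measurableI|].
by rewrite -setIYl; apply: negligibleS AB; exact: subIsetl.
Qed.

(** The event [A] is independent of the sigma-algebra generated by all the
    [G n], hence of its representative there, hence of itself. *)
Lemma zero_one_indep (G : nat -> set (set Om)) (A : set Om) :
  (forall n, G n `<=` measurable) ->
  (forall m n, (m <= n)%N -> G m `<=` G n) ->
  measurable A ->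
  (forall n C, <<s G n >> C -> P (A `&` C) = (P A * P C)%E) ->
  ae_closure <<s \bigcup_n G n >> A -> P A = 0%E \/ P A = 1%E.
Proof.
move=> mG ndG mA indA [B sB AB].
have smG n : <<s G n >> `<=` measurable.
  by apply: smallest_sub => //; exact: sigma_algebra_measurable.
have mC : \bigcup_n <<s G n >> `<=` measurable by move=> C [n _ /smG].
have {}sB : <<s \bigcup_n <<s G n >> >> B.
  by apply: sub_sigma_algebra2 sB => C [n _ GC]; exists n => //;
    exact: sub_sigma_algebra.
have mB : measurable B.
  by apply: smallest_sub sB => //; exact: sigma_algebra_measurable.
have PAB : P (A `&` B) = (P A * P B)%E.
  apply: (indep2_g_sigma (C := [set A])) sB => //.
  - by move=> _ _ -> ->; exact: setIid.
  - exact: bigcup_g_sigma_setI.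
  - by move=> _ ->.
  - by move=> _ C -> [n _ GC]; exact: indA GC.
  - exact: sub_sigma_algebra.
have PA := measure_setY_negligible mA mB AB.
have : P A = (P A * P A)%E.
  rewrite {3}PA -PAB; apply: measure_setY_negligible => //.
    exact: measurableI.
  apply: negligibleS AB => w /= [[Aw nAB]|[[] //]].
  by left; split => // Bw; apply: nAB.
have fA : P A \is a fin_num by exact: fin_num_measure.
rewrite -(fineK fA) -EFinM => -[/eqP].
rewrite eq_sym -subr_eq0 -{3}(mulr1 (fine _)) -mulrBr mulf_eq0 subr_eq0.
by case/orP=> /eqP ->; [left|right].
Qed.

End ae_closure.

(** * Measurability of argument lists *)

Section measurable_args.
Context d (U : measurableType d) dS (S : measurableType dS).

Lemma onth_mkseq T (f : nat -> T) m k :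
  onth (mkseq f m) k = if (k < m)%N then Some (f k) else None.
Proof.
rewrite onthE /mkseq -map_comp; case: ltnP => km.
  by rewrite (nth_mkseq None (Some \o f)).
by rewrite nth_default// size_map size_iota.
Qed.

Lemma measurable_args (N : U -> enat) (x : nat -> U -> S) :
  measurable_fun setT N -> (forall k, measurable_fun setT (x k)) ->
  measurable_fun setT (fun u => args (N u) (x ^~ u)).
Proof.
move=> mN mx; apply: (measurability (arglist_gen S)) => //.
move=> _ [_ [[n _ <-]|[k _ [A mA <-]]] <-]; rewrite setTI.
- have -> : (fun u => args (N u) (x ^~ u)) @^-1` [set w | arglen w = n] =
            N @^-1` [set n].
    by apply/seteqP; split=> u /=; case: (N u) => //= m; rewrite size_mkseq.
  by rewrite -[X in measurable X]setTI; exact: mN.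
- have -> : (fun u => args (N u) (x ^~ u)) @^-1`
              [set w | exists2 y, argnth w k = Some y & A y] =
            N @^-1` [set n | if n is Some m then (k < m)%N else True] `&`
              x k @^-1` A.
    apply/seteqP; split=> u /=; case: (N u) => [m|] /=.
    + by rewrite onth_mkseq; case: ifP => [_ [y [<-]]|_ []].
    + by case=> y [<-].
    + case=> km Ax; exists (x k u) => //.
      by rewrite onth_mkseq km.
    + by case=> _ Ax; exists (x k u).
  apply: measurableI; rewrite -[X in measurable X]setTI; first exact: mN.
  exact: mx.
Qed.

End measurable_args.

(** * Trajectories and subtrees *)

Section trajectories.
Context dT (Theta : measurableType dT) dS (S : measurableType dS).

(** A trajectory records the innovation and the state at every vertex; the whole
    tree and each subtree are random trajectories, so that they can be compared
    on the same events. *)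
Definition trajectory := seq nat -> (Theta * enat) * S.

HB.instance Definition _ := Pointed.on trajectory.

Definition innov_events (i : seq nat) : set (set trajectory) :=
  preimage_set_system setT (fun z : trajectory => (z i).1) measurable.

Definition state_events (i : seq nat) : set (set trajectory) :=
  preimage_set_system setT (fun z : trajectory => (z i).2) measurable.

(** Generators for the innovations before generation [n] and the states of
    generation [m]. *)
Definition level n m : set (set trajectory) :=
  \bigcup_(i in [set i | size i = m]) state_events i `|`
  \bigcup_(i in [set i | (size i < n)%N]) innov_events i.

Lemma sigma_algebra_innov_events i : sigma_algebra setT (innov_events i).
Proof. exact/sigma_algebra_preimage/sigma_algebra_measurable. Qed.

Lemma sigma_algebra_state_events i : sigma_algebra setT (state_events i).
Proof. exact/sigma_algebra_preimage/sigma_algebra_measurable. Qed.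

(** Recomputing every state from the innovation and the children.  An invariant
    process is almost surely a fixed point, see [subtree_recursion]. *)
Definition recursion (g : Theta * arglist S -> S) (z : trajectory) :
    trajectory :=
  fun i => ((z i).1,
            g ((z i).1.1, args (z i).1.2 (fun k => (z (rcons i k)).2))).

(** A state of generation [m] becomes a function of the innovation there, which
    is among those recorded because [m < n], and of the states of generation
    [m.+1]. *)
Lemma preimage_recursion g n m E :
  measurable_fun setT g -> (m < n)%N ->
  <<s level n m >> E -> <<s level n m.+1 >> (recursion g @^-1` E).
Proof.
move=> mg mn; apply: preimage_g_sigma; first exact: smallest_sigma_algebra.
move=> {}E [[i /= im [A mA <-]]|[i /= isn [A mA <-]]]; last first.
  by apply: sub_sigma_algebra; right; exists i => //; exists A.
(* The sigma-algebra generated by [level n m.+1], as a measurable space on which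
   the coordinates involved are measurable functions. *)
pose U : measurableType _ := g_sigma_algebraType (level n m.+1).
have mW : measurable_fun setT (fun z : U => (z i).1).
  move=> _ B mB; apply: sub_sigma_algebra; right; exists i; rewrite /= ?im//.
  by exists B.
have mX k : measurable_fun setT (fun z : U => (z (rcons i k)).2).
  move=> _ B mB; apply: sub_sigma_algebra; left; exists (rcons i k).
    by rewrite /= size_rcons im.
  by exists B.
have mgi : measurable_fun setT (fun z : U =>
    g ((z i).1.1, args (z i).1.2 (fun k => (z (rcons i k)).2))).
  apply: (measurableT_comp mg); apply: measurable_fun_pair.
    exact: (measurableT_comp measurable_fst mW).
  apply: (measurable_args (N := fun z : U => (z i).1.2)
    (x := fun k (z : U) => (z (rcons i k)).2)) => //.
  exact: (measurableT_comp measurable_snd mW).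
have := mgi measurableT A mA.
by rewrite !setTI.
Qed.

End trajectories.

(** * The law of a subtree *)

Section subtrees.
Context (R : realType) dT (Theta : measurableType dT)
  dS (S : measurableType dS) (nu : probability (Theta * enat)%type R)
  (g : Theta * arglist S -> S) (g_meas : measurable_fun setT g)
  (mu : probability S R)
  d (Om : measurableType d) (P : probability Om R)
  (W : seq nat -> {RV P >-> (Theta * enat)%type})
  (X : seq nat -> {RV P >-> S})
  (W_innov : innovation_process nu W) (X_rtp : invariant_rtp g mu W X).

Local Notation innov_events := (@innov_events _ Theta _ S).
Local Notation state_events := (@state_events _ Theta _ S).
Local Notation level := (@level _ Theta _ S).

Definition subtree (j : seq nat) (w : Om) : trajectory Theta S :=
  fun i => (W (j ++ i) w, X (j ++ i) w).

Lemma preimage_subtree_innov j i :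
  preimage_set_system setT (subtree j) (innov_events i) = sigma_rv (W (j ++ i)).
Proof. by rewrite -preimage_set_system_comp. Qed.

Lemma preimage_subtree_state j i :
  preimage_set_system setT (subtree j) (state_events i) = sigma_rv (X (j ++ i)).
Proof. by rewrite -preimage_set_system_comp. Qed.

Lemma measurable_subtree_innov j i E :
  innov_events i E -> measurable (subtree j @^-1` E).
Proof.
by case=> A mA <-; rewrite setTI; exact: (measurable_funPTI (W (j ++ i))).
Qed.

Lemma measurable_subtree_state j i E :
  state_events i E -> measurable (subtree j @^-1` E).
Proof.
by case=> A mA <-; rewrite setTI; exact: (measurable_funPTI (X (j ++ i))).
Qed.

Lemma measurable_subtree_level j n m E :
  level n m E -> measurable (subtree j @^-1` E).
Proof.
by case=> -[i _]; [exact: measurable_subtree_state|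
  exact: measurable_subtree_innov].
Qed.

Lemma measurable_subtree j n m E :
  <<s level n m >> E -> measurable (subtree j @^-1` E).
Proof.
apply: preimage_g_sigma; first exact: sigma_algebra_measurable.
by move=> {}E; exact: measurable_subtree_level.
Qed.

Lemma subtree_innov_family j (D D' : set (seq nat)) E :
  (forall i, D i -> D' (j ++ i)) ->
  <<s \bigcup_(i in D) innov_events i >> E ->
  sigma_family D' (fun i => W i : Om -> _) (subtree j @^-1` E).
Proof.
move=> DD'; apply: preimage_g_sigma; first exact: smallest_sigma_algebra.
move=> {}E [i Di EA]; apply: sub_sigma_algebra; exists (j ++ i).
  exact: DD'.
by rewrite -preimage_subtree_innov; exists E; rewrite ?setTI.
Qed.

Lemma subtree_state_family j (D D' : set (seq nat)) E :
  (forall i, D i -> D' (j ++ i)) ->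
  <<s \bigcup_(i in D) state_events i >> E ->
  sigma_family D' (fun i => X i : Om -> _) (subtree j @^-1` E).
Proof.
move=> DD'; apply: preimage_g_sigma; first exact: smallest_sigma_algebra.
move=> {}E [i Di EA]; apply: sub_sigma_algebra; exists (j ++ i).
  exact: DD'.
by rewrite -preimage_subtree_state; exists E; rewrite ?setTI.
Qed.

Definition same_law j (C : set (set (trajectory Theta S))) :=
  forall E, <<s C >> E -> P (subtree j @^-1` E) = P (subtree [::] @^-1` E).

Lemma cat_dropK (j : seq nat) : cancel (cat j) (drop (size j)).
Proof. by move=> i; rewrite drop_size_cat. Qed.

Lemma same_law_innov j D : same_law j (\bigcup_(i in D) innov_events i).
Proof.
have [lawW indW] := W_innov.
have ind j' : mutual_indep P D
    (fun i => preimage_set_system setT (subtree j') (innov_events i)).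
  have -> : (fun i => preimage_set_system setT (subtree j') (innov_events i)) =
      (fun i => sigma_rv (W i)) \o cat j'.
    by apply/funext => i; exact: preimage_subtree_innov.
  by apply: (mutual_indep_reindex (@cat_dropK j') _ indW).
apply: (mutual_indep_law _ _ _ (ind j) (ind [::])).
- exact: sigma_algebra_innov_events.
- by move=> i E; exact: measurable_subtree_innov.
- by move=> i E; exact: measurable_subtree_innov.
- move=> i _ [A mA <-]; rewrite !setTI.
  exact: (etrans (lawW (j ++ i) A mA) (esym (lawW i A mA))).
Qed.

Lemma same_law_state j n :
  same_law j (\bigcup_(i in [set i | size i = n]) state_events i).
Proof.
have [lawX indX _ _] := X_rtp.
have ind j' : mutual_indep P [set i | size i = n]
    (fun i => preimage_set_system setT (subtree j') (state_events i)).
  have -> : (fun i => preimage_set_system setT (subtree j') (state_events i)) =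
      (fun i => sigma_rv (X i)) \o cat j'.
    by apply/funext => i; exact: preimage_subtree_state.
  apply: (mutual_indep_reindex (@cat_dropK j') _ (indX (size j' + n)%N)).
  by move=> i /= <-; rewrite size_cat.
apply: (mutual_indep_law _ _ _ (ind j) (ind [::])).
- exact: sigma_algebra_state_events.
- by move=> i E; exact: measurable_subtree_state.
- by move=> i E; exact: measurable_subtree_state.
- move=> i _ [A mA <-]; rewrite !setTI.
  exact: (etrans (lawX (j ++ i) A mA) (esym (lawX i A mA))).
Qed.

(** The states of generation [n] of the subtree at [j] are states of generation
    [size j + n] of the tree, and its innovations before generation [n] come
    before that one, so that the independence of a generation from the past
    applies to the subtree. *)
Lemma same_law_generation j n : same_law j (level n n).
Proof.
have [_ _ _ indXW] := X_rtp.
have ind j' : indep2 P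
    (preimage_set_system setT (subtree j')
       <<s \bigcup_(i in [set i | size i = n]) state_events i >>)
    (preimage_set_system setT (subtree j')
       <<s \bigcup_(i in [set i | (size i < n)%N]) innov_events i >>).
  move=> _ _ [A sA <-] [B sB <-]; rewrite !setTI.
  apply: (indXW (size j' + n)%N).
    by apply: subtree_state_family sA => i /= <-; rewrite size_cat.
  by apply: subtree_innov_family sB => i /=; rewrite size_cat ltn_add2l.
apply: (indep2_law _ _ (ind j) (ind [::])).
- by move=> E; exact: measurable_subtree_level.
- by move=> E; exact: measurable_subtree_level.
- exact: same_law_state.
- exact: same_law_innov.
Qed.

(** There are countably many vertices, so the recursion holds at all of them
    simultaneously outside one null set. *)
Lemma subtree_recursion j :
  {ae P, forall w, subtree j w = recursion g (subtree j w)}.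
Proof.
have [_ _ rec _] := X_rtp.
pose eqn (i : seq nat) w :=
  X (j ++ i) w = g ((W (j ++ i) w).1,
                    args (W (j ++ i) w).2 (fun k => X (j ++ rcons i k) w)).
have ae_eqn i : {ae P, forall w, eqn i w}.
  by apply: filterS (rec (j ++ i)) => w; under eq_fun do rewrite rcons_cat.
have : {ae P, forall w, forall k, eqn (odflt [::] (choice.unpickle k)) w}.
  by apply: ae_foralln => k; exact: ae_eqn.
apply: filterS => w eqw; apply/funext => i.
have := eqw (choice.pickle i); rewrite choice.pickleK /= => eqi.
by rewrite /recursion /subtree /= -eqi.
Qed.

(** Descending induction on [m] from [m = n]: applying [recursion] changes
    neither probability and turns an event about generation [m] into one about
    generation [m.+1]. *)
Lemma same_law_level j n m : (m <= n)%N -> same_law j (level n m).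
Proof.
move=> mn; rewrite -(subKn mn); elim: (n - m)%N (leq_subr m n)
  => {m mn} [|k IH] kn.
  by rewrite subn0; exact: same_law_generation.
have nk : (n - k = (n - k.+1).+1)%N by rewrite subnSK.
have nkn : (n - k.+1 < n)%N by rewrite ltn_subrL /= (leq_ltn_trans _ kn).
move=> E sE; have sRE := preimage_recursion g_meas nkn sE; rewrite -nk in sRE.
have rec i : P (subtree i @^-1` E) = P (subtree i @^-1` (recursion g @^-1` E)).
  apply: (measure_ae_preimage (Z2 := recursion g \o subtree i)).
  - exact: subtree_recursion.
  - exact: measurable_subtree sE.
  - exact: (@measurable_subtree i _ _ _ sRE).
by rewrite !rec; apply: IH => //; exact: ltnW.
Qed.

(** The cut at depth [n] has disappeared: the events that involve finitely many
    innovations are in [level n 0] for [n] large. *)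
Lemma same_law_root j :
  same_law j (state_events [::] `|` \bigcup_(i in setT) innov_events i).
Proof.
move=> E sE.
have {}sE : <<s \bigcup_n <<s level n 0 >> >> E.
  apply: sub_sigma_algebra2 sE => A [A0|[i _ Ai]].
    by exists 0%N => //; apply: sub_sigma_algebra; left; exists [::].
  exists (size i).+1 => //; apply: sub_sigma_algebra; right; exists i => //=.
apply: (eq_measure_g_sigma _ _ _ _ _ sE) => //.
- apply: bigcup_g_sigma_setI => m n mn A [A0|[i /= im Ai]]; first by left.
  by right; exists i => //=; exact: leq_trans mn.
- by move=> A [n _]; exact: measurable_subtree.
- by move=> A [n _]; exact: measurable_subtree.
- by move=> A [n _]; exact: same_law_level.
Qed.

(** Endogeny provides an innovation event [C] whose symmetric difference with the
    event that the root state is in [A] is null.  That difference is an event on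
    trajectories that involves only the root state and the innovations, so it is
    null in the subtree at [j] too. *)
Lemma endogenous_subtree j : endogenous W X ->
  sigma_rv (X j) `<=` ae_closure P
    (sigma_family [set i | (size j <= size i)%N] (fun i => W i : Om -> _)).
Proof.
move=> endoX _ [A mA <-]; rewrite setTI.
have /endoX/ae_closure_complete : sigma_rv (X [::]) (X [::] @^-1` A).
  by exists A; rewrite ?setTI.
case; first exact: smallest_sigma_algebra.
move=> B GB AB.
have [C sC CB] : exists2 C, <<s \bigcup_(i in setT) innov_events i >> C &
    subtree [::] @^-1` C = B.
  have : preimage_set_system setT (subtree [::])
      <<s \bigcup_(i in setT) innov_events i >> B.
    move: B GB {AB}; apply: smallest_sub.
      exact/sigma_algebra_preimage/smallest_sigma_algebra.
    move=> B [i _]; rewrite -[i in sigma_rv (W i)]cat0s -preimage_subtree_innov.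
    move=> [C iC <-]; exists C => //.
    by apply: sub_sigma_algebra; exists i.
  by case=> C sC; rewrite setTI => <-; exists C.
pose E : set (trajectory Theta S) := [set z | A (z [::]).2] `+` C.
have sE : <<s state_events [::] `|` \bigcup_(i in setT) innov_events i >> E.
  apply: (sigma_algebra_setY (smallest_sigma_algebra _ _)).
    by apply: sub_sigma_algebra; left; exists A; rewrite ?setTI.
  by apply: sub_sigma_algebra2 sC => ? ?; right.
have mE i : measurable (subtree i @^-1` E).
  apply: preimage_g_sigma sE; first exact: sigma_algebra_measurable.
  by move=> F [|[k _]]; [exact: measurable_subtree_state|
    exact: measurable_subtree_innov].
exists (subtree j @^-1` C).
  apply: subtree_innov_family sC => i _ /=.
  by rewrite size_cat leq_addr.
have -> : X j @^-1` A `+` subtree j @^-1` C = subtree j @^-1` E.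
  by rewrite /E /subtree; apply/seteqP; split => w; rewrite /= ?cats0.
apply/(negligibleP _ (mE j)); apply: (etrans (same_law_root j sE)).
by apply/(negligibleP _ (mE [::])); move: AB; rewrite -CB.
Qed.

End subtrees.

(** * Triviality of the tail *)

Theorem proposition1 (R : realType)
  (dT : measure_display) (Theta : measurableType dT)
  (dS : measure_display) (S : measurableType dS)
  (nu : probability (Theta * enat)%type R)
  (g : Theta * arglist S -> S)
  (g_meas : measurable_fun [set: Theta * arglist S] g)
  (mu : probability S R)
  (mu_sol : rde_solution nu g mu)
  (d : measure_display) (Om : measurableType d) (P : probability Om R)
  (W : seq nat -> {RV P >-> (Theta * enat)%type})
  (X : seq nat -> {RV P >-> S})
  (W_innov : innovation_process nu W)
  (X_rtp : invariant_rtp g mu W X) :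
  endogenous W X -> trivial_sigma P (tail_sigma X).
Proof.
move=> endoX A tailA.
pose before n := \bigcup_(i in [set i | (size i < n)%N]) sigma_rv (W i).
pose after n :=
  sigma_family [set i | (n <= size i)%N] (fun i => W i : Om -> _).
have m_family (D : set (seq nat)) d' (T : measurableType d')
    (Y : seq nat -> {RV P >-> T}) :
    sigma_family D (fun i => Y i : Om -> _) `<=` measurable.
  apply: smallest_sub; first exact: sigma_algebra_measurable.
  by move=> _ [i _ [B mB <-]]; rewrite setTI; exact: (measurable_funPTI (Y i)).
have sW i : sigma_algebra setT (sigma_rv (W i)).
  exact/sigma_algebra_preimage/sigma_algebra_measurable.
have mW i : sigma_rv (W i) `<=` measurable.
  by move=> _ [B mB <-]; rewrite setTI; exact: (measurable_funPTI (W i)).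
have mA : measurable A by apply: m_family (tailA 0%N _).
(* Every state of depth at least [n] is determined by the innovations below it,
   which have depth at least [n]. *)
have Aafter n : ae_closure P (after n) A.
  apply: smallest_sub (tailA n I).
    exact/sigma_algebra_ae_closure/smallest_sigma_algebra.
  move=> B [i /= ni] /(endogenous_subtree g_meas W_innov X_rtp endoX).
  apply: sub_ae_closure; apply: sub_sigma_algebra2.
  by apply: bigcup_subset => k /=; exact: leq_trans.
have [_ indW] := W_innov.
apply: (zero_one_indep (G := before)) => //.
- by move=> n B [i _ /mW].
- by move=> m n mn; apply: bigcup_subset => i /= im; exact: leq_trans mn.
- move=> n C sC;
  apply: (@ae_closure_indep2 _ _ _ _ (after n) <<s before n >>) => //.
  + exact: m_family.
  + exact: (m_family _ _ _ W).
  + apply: (mutual_indep_disjoint sW mW _ _ _ indW) => //.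
    apply/seteqP; split=> i //= [ni].
    by rewrite ltnNge ni.
- apply: sub_ae_closure (Aafter 0%N) => B.
  apply: sub_sigma_algebra2 => C [i _ iC].
  by exists (size i).+1 => //; exists i => /=.
Qed.
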